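(* Let $T\ge 1$ and let $p$ be a $T$-period random joint choice rule on a finite set $X$. Then $p$ is consistent with consumption dependent random utility if and only if it satisfies marginality and complete monotonicity.
   Context: $\mathcal{X}$ is the set of nonempty subsets of $X$, $\mathcal{L}(X)$ the linear orders, $N(x,A)=\{\succ: x\succ y\ \forall y\in A\setminus\{x\}\}$. For vectors, $\mathbf{x}^\tau=(x_1,\dots,x_\tau)$, $\mathbf{A}^\tau=(A_1,\dots,A_\tau)\in\mathcal{X}^\tau$, $\succ^\tau=(\succ_1,\dots,\succ_\tau)$, and $\mathbf{x}^\tau\in\mathbf{A}^\tau$ means $x_i\in A_i$ for all $i$. A $T$-period random joint choice rule assigns to each $\mathbf{A}^T\in\mathcal{X}^T$ and $\mathbf{x}^T\in\mathbf{A}^T$ a number $p(\mathbf{x}^T,\mathbf{A}^T)\ge0$ with $\sum_{\mathbf{x}^T\in\mathbf{A}^T}p(\mathbf{x}^T,\mathbf{A}^T)=1$. For $\tau<T$ define recursively $p(\mathbf{x}^\tau,\mathbf{A}^\tau)=\sum_{y\in X}p(\mathbf{x}^\tau,y,\mathbf{A}^\tau,X)$. Marginality: for every $\tau\in\{1,\dots,T-1\}$, $\mathbf{A}^\tau\in\mathcal{X}^\tau$, $\mathbf{x}^\tau\in\mathbf{A}^\tau$ and $B,C\in\mathcal{X}$, $\sum_{y\in B}p(\mathbf{x}^\tau,y,\mathbf{A}^\tau,B)=\sum_{y\in C}p(\mathbf{x}^\tau,y,\mathbf{A}^\tau,C)$. The Möbius inverse $q$ is defined by $p(\mathbf{x}^T,\mathbf{A}^T)=\sum_{A_1\subseteq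 A_1'\subseteq X}\cdots\sum_{A_T\subseteq A_T'\subseteq X}q(\mathbf{x}^T,A_1',\dots,A_T')$; complete monotonicity means $q(\mathbf{x}^T,\mathbf{A}^T)\ge0$ for all $\mathbf{A}^T$, $\mathbf{x}^T\in\mathbf{A}^T$. A transition function of degree $n$ is a map $t^n:X^n\times\mathcal{L}(X)^n\to\Delta(\mathcal{L}(X))$, with $t^n_{\succ'}(\cdot)$ the probability of $\succ'$. $p$ is consistent with consumption dependent random utility if there exist $\nu\in\Delta(\mathcal{L}(X))$ and transition functions $t^1,\dots,t^{T-1}$ ($t^n$ of degree $n$) such that for all $\mathbf{A}^T$, $\mathbf{x}^T\in\mathbf{A}^T$: $p(\mathbf{x}^T,\mathbf{A}^T)=\sum_{\succ_1\in N(x_1,A_1)}\cdots\sum_{\succ_T\in N(x_T,A_T)}\nu(\succ_1)\prod_{\tau=2}^T t^{\tau-1}_{\succ_\tau}(\mathbf{x}^{\tau-1},\succ^{\tau-1})$. *)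

(* Defs.v *)
From HB Require Import structures.
From mathcomp Require Import all_boot all_order all_algebra.
From mathcomp Require Import reals.
Set Implicit Arguments. Unset Strict Implicit. Unset Printing Implicit Defensive.
Import Order.TTheory GRing.Theory Num.Theory.
Local Open Scope ring_scope.

Section Defs.
Variable X : finType.

(* Strict linear orders on X: r (x, y) means x ≻ y. *)
Definition is_lin (r : {ffun X * X -> bool}) : bool :=
  [&& [forall x, ~~ r (x, x)],
      [forall x, forall y, forall z, r (x, y) && r (y, z) ==> r (x, z)]
    & [forall x, forall y, (x != y) ==> r (x, y) || r (y, x)]].

Definition lin := {r : {ffun X * X -> bool} | is_lin r}.

Definition Nset (x : X) (A : {set X}) : {set lin} :=
  [set o : lin | [forall y in A, (y != x) ==> val o (x, y)]].

Variable R : realType.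
Variable T : nat.

Definition vX := {ffun 'I_T -> X}.
Definition vA := {ffun 'I_T -> {set X}}.

Definition vin (x : vX) (A : vA) : bool := [forall i, x i \in A i].
Definition vne (A : vA) : bool := [forall i, A i != set0].

Definition is_rjcr (p : vX -> vA -> R) : Prop :=
  forall A : vA, vne A ->
    (forall x : vX, vin x A -> 0 <= p x A) /\
    \sum_(x : vX | vin x A) p x A = 1.

Definition upd (U : Type) (f : {ffun 'I_T -> U}) (i : nat) (u : U)
  : {ffun 'I_T -> U} := [ffun j : 'I_T => if nat_of_ord j == i then u else f j].

(* marg p k x A = p(x^τ, A^τ) with τ = T - k, defined by the recursion
   p(x^τ, A^τ) = Σ_y p(x^τ, y, A^τ, X); only the first τ coordinates
   of x and A are used. *)
Fixpoint marg (p : vX -> vA -> R) (k : nat) (x : vX) (A : vA) : R :=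
  match k with
  | 0 => p x A
  | k'.+1 => \sum_(y : X) marg p k' (upd x (T - k) y) (upd A (T - k) setT)
  end.

Definition marginality (p : vX -> vA -> R) : Prop :=
  forall tau : nat, (1 <= tau <= T - 1)%N ->
  forall (x : vX) (A : vA),
    (forall i : 'I_T, (i < tau)%N -> A i != set0) ->
    (forall i : 'I_T, (i < tau)%N -> x i \in A i) ->
  forall B C : {set X}, B != set0 -> C != set0 ->
    \sum_(y in B) marg p (T - tau.+1) (upd x tau y) (upd A tau B)
    = \sum_(y in C) marg p (T - tau.+1) (upd x tau y) (upd A tau C).

Definition mobius (p : vX -> vA -> R) (x : vX) (A : vA) : R :=
  \sum_(A' : vA | [forall i, A i \subset A' i])
     (-1) ^+ (\sum_i #|A' i :\: A i|)%N * p x A'.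

Definition complete_monotonicity (p : vX -> vA -> R) : Prop :=
  forall (x : vX) (A : vA), vne A -> vin x A -> 0 <= mobius p x A.

Definition pre (U : Type) (i : 'I_T) (f : {ffun 'I_T -> U}) : i.-tuple U :=
  [tuple f (widen_ord (ltnW (ltn_ord i)) j) | j < i].

Definition is_distr (U : finType) (mu : U -> R) : Prop :=
  (forall u, 0 <= mu u) /\ \sum_u mu u = 1.

Definition cdru (p : vX -> vA -> R) : Prop :=
  exists (nu : lin -> R)
         (t : forall n : nat, n.-tuple X -> n.-tuple lin -> lin -> R),
    is_distr nu /\
    (forall n : nat, (1 <= n <= T - 1)%N ->
       forall (xs : n.-tuple X) (os : n.-tuple lin), is_distr (t n xs os)) /\
    (forall (x : vX) (A : vA), vne A -> vin x A ->
       p x A =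
       \sum_(o : {ffun 'I_T -> lin} | [forall i, o i \in Nset (x i) (A i)])
         \prod_(i : 'I_T)
            (if nat_of_ord i == 0%N then nu (o i)
             else t i (pre i x) (pre i o) (o i))).

End Defs.

(* Main.v *)
Require Import Defs.
From HB Require Import structures.
From mathcomp Require Import all_boot all_order all_algebra.
From mathcomp Require Import reals.
From mathcomp Require Import lra zify.
Set Implicit Arguments. Unset Strict Implicit. Unset Printing Implicit Defensive.
Import Order.TTheory GRing.Theory Num.Theory.
Local Open Scope ring_scope.

(* An order [l] lies in N(y, B) iff B is contained in the lower set
   {z | y = z or y l z}, so for a single period the Moebius inverse q(y, B) is the
   probability that the lower set of y is exactly B. Read q(y, B) as the flow along
   the edge B -> B \ {y}: that the choice probabilities sum to one on every menu
   is conservation of this flow, and linear orders are the maximal chains of sets,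
   so a nonnegative q decomposes into a measure on linear orders.

   For T periods, marginality says that, for a fixed past (x^k, A^k), the Moebius
   inverse of period k+1 is such a flow, of total value q(x^k, A^k). Its
   decomposition divided by q(x^k, A^k) is the transition after a past with
   choices x^k and lower sets A^k, and by induction the histories with choices x^k
   and lower sets A^k have probability q(x^k, A^k). Conversely the Moebius
   inverse of a consistent rule is a probability of histories, hence nonnegative. *)

(** * Flows on the subset lattice *)

Section Orders.
Variable X : finType.
Implicit Types (l : lin X) (x y z : X) (B : {set X}).

Definition lower l y : {set X} := [set z | (z == y) || val l (y, z)].

Lemma lower_refl l y : y \in lower l y.
Proof. by rewrite inE eqxx. Qed.

Lemma in_Nset l y B : (l \in Nset y B) = (B \subset lower l y).
Proof.
rewrite inE; apply/forallP/subsetP => [H z zB|H z].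
  by have := H z; rewrite zB inE /=; case: eqP.
by apply/implyP => /H; rewrite inE; case: eqP.
Qed.

Lemma lin_trans l x y z : val l (x, y) -> val l (y, z) -> val l (x, z).
Proof.
move=> xy yz; have /and3P[_ /forallP/(_ x)/forallP/(_ y)/forallP/(_ z) H _] := valP l.
by rewrite xy yz in H.
Qed.

Lemma lin_irr l x : val l (x, x) = false.
Proof. by have /and3P[/forallP/(_ x)/negbTE ] := valP l. Qed.

Lemma lin_total l x y : x != y -> val l (x, y) || val l (y, x).
Proof.
by move=> xy; have /and3P[_ _ /forallP/(_ x)/forallP/(_ y)] := valP l; rewrite xy.
Qed.

Lemma lower_sub l y z : z \in lower l y -> lower l z \subset lower l y.
Proof.
rewrite inE => /predU1P[->//|yz]; apply/subsetP => u; rewrite !inE.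
by case/predU1P => [->|zu]; rewrite ?yz ?orbT // (lin_trans yz zu) orbT.
Qed.

(** The element of [B] with the largest lower set is the maximum: any [u] above it would have a
    strictly larger one. *)
Lemma max_exists l B : B != set0 ->
  exists2 y, y \in B & forall z, z \in B -> (B \subset lower l z) = (z == y).
Proof.
case/set0Pn => y0 y0B.
case: (arg_maxnP (fun y => #|lower l y|) y0B) => y yB ymax; exists y => // z zB.
have sub : B \subset lower l y.
  apply/subsetP => u uB; rewrite inE; case: (eqVneq u y) => //= /(lin_total l) /orP[uy|//].
  have suby : lower l y \proper lower l u.
    apply/properP; split; first by apply: lower_sub; rewrite inE uy orbT.
    exists u; rewrite ?lower_refl // inE; apply/norP; split.
      by apply: contraTneq uy => ->; rewrite lin_irr.
    by apply/negP => yu; have := lin_trans uy yu; rewrite lin_irr.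
  by have := proper_card suby; rewrite ltnNge => /negP[]; apply: ymax.
apply/idP/eqP => [/subsetP/(_ y yB)|->//]; rewrite inE => /predU1P[->//|zy].
have := subsetP sub _ zB; rewrite inE => /predU1P[//|yz].
by have := lin_trans zy yz; rewrite lin_irr.
Qed.

Lemma sum_max (R : nzSemiRingType) l B : B != set0 ->
  \sum_(y in B) (B \subset lower l y)%:R = 1 :> R.
Proof.
move=> /(max_exists l) [y yB H]; rewrite (bigD1 y) //= H // eqxx big1 ?addr0 //.
by move=> z /andP[zB zy]; rewrite H // (negbTE zy).
Qed.

(** Reads [s] from best to worst, so that lower sets are the suffixes of [s]. *)
Lemma seq_lin (s : seq X) : uniq s -> s =i predT ->
  exists l, forall y, lower l y = [set z | (index y s <= index z s)%N].
Proof.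
move=> us sX; pose r := [ffun xy : X * X => (index xy.1 s < index xy.2 s)%N].
have idx x y : index x s = index y s -> x = y.
  by move=> e; rewrite -(nth_index x (sX x)) e nth_index ?sX.
have rP : is_lin r.
  apply/and3P; split; first by apply/forallP=> x; rewrite ffunE ltnn.
    do 3 (apply/forallP => ?); rewrite !ffunE /=; apply/implyP => /andP[]; exact: ltn_trans.
  do 2 (apply/forallP => ?); apply/implyP => ne; rewrite !ffunE /= -neq_ltn.
  by apply: contraNneq ne => /idx ->.
exists (Sub r rP) => y; apply/setP => z; rewrite !inE SubK ffunE /= [RHS]leq_eqVlt.
by congr (_ || _); apply/eqP/eqP => [->|/idx ->].
Qed.

Lemma lin_inhabited : exists l : lin X, True.
Proof.
have [||l _] := @seq_lin (enum X); first exact: enum_uniq.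
- by move=> x; rewrite mem_enum.
- by exists l.
Qed.

End Orders.

(** The zeta transform is unitriangular, so strong induction on the rank [m] cancels all terms but
    the one at [A]. The up-closed [P] restricts attention to the menus where the sums are known to
    agree. *)
Lemma zeta_inj (V : zmodType) (I : finType) (P : pred I) (le : rel I) (m : I -> nat)
    (F G : I -> V) :
  reflexive le -> (forall A B, P A -> le A B -> P B) ->
  (forall A B, le A B -> A != B -> (m B < m A)%N) ->
  (forall A, P A -> \sum_(B | le A B) F B = \sum_(B | le A B) G B) ->
  forall A, P A -> F A = G A.
Proof.
move=> le0 Pup mlt H A; have [n] := ubnP (m A); elim: n A => // n IH A mA PA.
have := H A PA; rewrite (bigD1 A) ?le0 //= [in RHS](bigD1 A) ?le0 //=.
rewrite [X in _ + X = _](eq_bigr G); first by move/addIr.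
move=> B /andP[AB BA]; apply: IH; last exact: Pup AB.
by rewrite eq_sym in BA; have := mlt _ _ AB BA; lia.
Qed.

Section Flow.
Variables (X : finType) (R : realFieldType).
Implicit Types (B C : {set X}) (h : X -> {set X} -> R).

(** If [B] differs from [C], toggling membership of a fixed [z] in [C :\: B] is a sign-reversing
    involution of the interval, so the sum is its own opposite. *)
Lemma altsum B C : B \subset C ->
  \sum_(D : {set X} | (B \subset D) && (D \subset C)) (-1) ^+ #|D :\: B|
   = (B == C)%:R :> R.
Proof.
move=> BC; case: eqP => [<-|/eqP ne].
  rewrite (big_pred1 B) => [|D]; first by rewrite setDv cards0.
  by rewrite -eqEsubset eq_sym.
have /set0Pn[z] : C :\: B != set0.
  by rewrite setD_eq0; apply: contra ne => CB; rewrite eqEsubset BC.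
rewrite inE => /andP[zB zC].
pose t (D : {set X}) := if z \in D then D :\ z else z |: D.
have tK : involutive t.
  move=> D; rewrite /t; case: (boolP (z \in D)) => zD.
    by rewrite setD11 setD1K.
  by rewrite setU11 setU1K.
have self_opp (u : R) : u = - u -> u = 0 by lra.
apply: self_opp; rewrite {1}(reindex_inj (inv_inj tK)) -sumrN; apply: eq_big => [D|D _].
  rewrite /t; case: ifP => zD.
    by rewrite subsetD1 zB andbT subDset (setUidPr _) ?sub1set.
  rewrite subUset sub1set zC /=; congr (_ && _).
  apply/subsetP/subsetP => H y yB; last by rewrite inE H ?orbT.
  by have := H y yB; rewrite !inE; case: eqP => // e; rewrite -e yB in zB.
rewrite /t; case: ifP => zD.
  rewrite [in RHS](cardsD1 z) !inE zD zB /= exprS mulN1r opprK.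
  by congr (_ ^+ _); apply: eq_card => y; rewrite !inE; case: (y == z); rewrite ?andbF.
rewrite [in LHS](cardsD1 z) !inE eqxx zB /= exprS mulN1r.
congr (- (_ ^+ _)); apply: eq_card => y; rewrite !inE.
by case: eqP => // ->; rewrite zD andbF.
Qed.

Definition outflow h B := \sum_(y in B) h y B.
(** The inner sum is the choice probability whose Moebius inverse is [h]; the condition is its
    normalization to [c] on each menu. *)
Definition is_flow h (c : R) := forall B, B != set0 ->
  \sum_(y in B) \sum_(B' : {set X} | B \subset B') h y B' = c.

(** Kirchhoff's law at the node [B], with a source of strength [c] at the full set. Both sides have
    the same zeta transform. *)
Lemma flow_conservation h c : is_flow h c -> forall B, B != set0 ->
  outflow h B = \sum_(z in ~: B) h z (z |: B) + c * (B == setT)%:R.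
Proof.
move=> fl; apply: (zeta_inj (le := fun A B : {set X} => A \subset B) (m := fun B => #|~: B|)).
- by move=> B.
- by move=> A B /set0Pn[x xA] /subsetP AB; apply/set0Pn; exists x; apply: AB.
- move=> A B AB ne; apply: proper_card; rewrite properE !setCS AB /=.
  by apply: contra ne => BA; rewrite eqEsubset AB.
move=> B Bne; rewrite big_split /= -mulr_sumr.
have -> : \sum_(B' : {set X} | B \subset B') (B' == setT)%:R = 1 :> R.
  rewrite (bigD1 setT) ?subsetT //= eqxx big1 ?addr0 // => C /andP[_ /negbTE->//].
rewrite mulr1 -(fl B Bne) exchange_big /= [in RHS]addrC.
(* The edges leaving supersets [C] of [B] either remove an element of [B], which gives [c], or stay
   above [B]; the latter are the edges entering a superset of [B]. *)
transitivity (\sum_(C : {set X} | B \subset C) \sum_(y in B) h y C +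
   \sum_(C : {set X} | B \subset C) \sum_(y in C :\: B) h y C).
  rewrite -big_split; apply: eq_bigr => C BC; rewrite /outflow (bigID (mem B)) /=.
  congr (_ + _); apply: eq_bigl => y; last by rewrite inE andbC.
  by apply: andb_idl; apply: (subsetP BC).
congr (_ + _); rewrite !pair_big_dep /=.
rewrite (reindex_onto (fun u => (u.2 |: u.1, u.2)) (fun u => (u.1 :\ u.2, u.2))) /=.
  apply: eq_bigl => -[C y] /=; rewrite !inE eqxx /= andbT xpair_eqE eqxx andbT.
  case: (boolP (y \in C)) => yC; rewrite ?andbF /=.
    apply/negP => /andP[_ /eqP/setP/(_ y)]; by rewrite !inE eqxx yC.
  rewrite setU1K // eqxx andbT !andbT.
  apply/andP/idP => [[/subsetP H yB]|BC].
    apply/subsetP => z zB; have := H z zB; rewrite !inE; case: eqP => // e.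
    by rewrite -e zB in yB.
  split; first by rewrite (subset_trans BC) // subsetUr.
  by apply: contra yC; apply: (subsetP BC).
by move=> [C y] /= /andP[_]; rewrite inE => /andP[_ yC]; rewrite setD1K.
Qed.

(** A path of positive flow down to the empty set, encoded by the order in which elements are
    removed. *)
Fixpoint chain h (s : seq X) := if s is y :: s' then
  (0 < h y [set z in s]) && chain h s' else true.

(** Descend along a positive edge from [B] to [B :\ y]: the inflow there is positive, hence by
    conservation so is the outflow, until the empty set is reached. *)
Lemma chain_exists h c B : (forall y B, y \in B -> 0 <= h y B) -> is_flow h c ->
  B != set0 -> 0 < outflow h B -> exists s, [/\ uniq s, s =i B & chain h s].
Proof.
move=> h0 fl; have [n] := ubnP #|B|; elim: n B => // n IH B nB Bne.
case: (pickP (fun y => (y \in B) && (0 < h y B))) => [y /andP[yB hy] _|H]; last first.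
  rewrite /outflow big1 ?ltxx // => y yB; apply/eqP; have := H y; rewrite yB /= => /negbT.
  by rewrite lt_neqAle h0 // andbT negbK eq_sym.
have Bs s : uniq s -> s =i B :\ y -> chain h s -> exists s, [/\ uniq s, s =i B & chain h s].
  move=> us sB cs; have sy : y :: s =i B.
    by move=> z; rewrite inE sB !inE; case: eqP => // ->.
  exists (y :: s); split => //=; first by rewrite us sB !inE eqxx.
  rewrite cs andbT (_ : [set z in _] = B) //.
  by apply/setP => z; rewrite inE; apply: sy.
have [e|ne] := eqVneq (B :\ y) set0.
  by apply: (Bs [::]) => // z; rewrite e !inE.
have [|//||s [us sB cs]] := IH (B :\ y); last exact: (Bs s).
  by move: nB; rewrite (cardsD1 y) yB.
rewrite (flow_conservation fl) //; have -> : (B :\ y == setT) = false.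
  by apply/negP => /eqP/setP/(_ y); rewrite !inE eqxx.
rewrite mulr0 addr0 (bigD1 y) ?inE ?eqxx //= setD1K //.
apply: ltr_pwDl => //; apply: sumr_ge0 => z _; apply: h0; exact: setU11.
Qed.

(** Identifies the nodes of the path with the lower sets given by [seq_lin]. *)
Lemma chain_lower h s y : uniq s -> chain h s -> y \in s ->
  0 < h y [set z in s | (index y s <= index z s)%N].
Proof.
elim: s => //= x s IH /andP[xs us] /andP[hx cs]; rewrite inE.
have [-> _|ne /= ys] := eqVneq y x.
  rewrite (_ : [set z in _ | _] = [set z in x :: s]) //.
  by apply/setP => z; rewrite !inE andbT.
have := IH us cs ys; congr (0 < h y _); apply/setP => z.
rewrite !inE [x == _]eq_sym.
by case: eqP => //= ->; rewrite (negbTE xs).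
Qed.

(* Greedy decomposition: as long as the flow is nonzero, some order has positive
   flow along its whole chain of lower sets, and removing the minimum of these
   values annihilates one more edge. *)
Lemma flow_decomposition h c :
  (forall y B, y \in B -> 0 <= h y B) -> is_flow h c ->
  exists2 mu : lin X -> R, (forall l, 0 <= mu l) &
    forall y B, y \in B -> \sum_(l | lower l y == B) mu l = h y B.
Proof.
pose supp h := [set u : X * {set X} | (u.1 \in u.2) && (h u.1 u.2 != 0)].
have [n] := ubnP #|supp h|; elim: n h c => // n IH h c sn h0 fl.
have [e|/set0Pn[[y0 B0]]] := eqVneq (supp h) set0.
  exists (fun=> 0) => // y B yB; rewrite big1 //; apply/esym/eqP.
  by have /setP/(_ (y, B)) := e; rewrite !inE yB /=; move/negbFE.
rewrite inE /= => /andP[y0B0 hy0].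
(* On the menu [[set y0]] the value [c] is a sum of nonnegative terms, one of which is [h y0 B0]. *)
have cpos : 0 < c.
  rewrite -(fl [set y0]) ?big_set1; last by apply/set0Pn; exists y0; rewrite inE.
  rewrite (bigD1 B0) ?sub1set //=; apply: ltr_pwDl.
    by rewrite lt_neqAle eq_sym hy0 h0.
  by apply: sumr_ge0 => B /andP[+ _]; rewrite sub1set; apply: h0.
have [||s [us sX cs]] := chain_exists h0 fl (B := setT).
- by apply/set0Pn; exists y0.
- rewrite (flow_conservation fl) ?eqxx ?mulr1; last by apply/set0Pn; exists y0.
  by rewrite setCT big_set0 add0r.
have sT : s =i predT by move=> z; rewrite sX inE.
have [l lE] := seq_lin us sT.
have hl y : 0 < h y (lower l y).
  have := chain_lower us cs (sT y); congr (0 < h y _).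
  by apply/setP => z; rewrite lE !inE sT.
pose y1 := [arg min_(y < y0 | true) h y (lower l y)]%O.
have y1min y : h y1 (lower l y1) <= h y (lower l y).
  by rewrite /y1; case: arg_minP => //= ? _; apply.
pose m := h y1 (lower l y1); have m0 : 0 < m by exact: hl.
pose h' y B := h y B - m * (lower l y == B)%:R.
have [|||mu mu0 muE] := IH h' (c - m).
- have: supp h' \proper supp h.
    apply/properP; split; last first.
      exists (y1, lower l y1); rewrite inE /= lower_refl /=; first by rewrite gt_eqF ?hl.
      by rewrite /h' eqxx mulr1 subrr eqxx.
    apply/subsetP => -[y B]; rewrite !inE /= => /andP[-> /=].
    rewrite /h'; case: (lower l y =P B) => [<- _|_]; last by rewrite mulr0 subr0.
    by rewrite gt_eqF ?hl.
  by move/proper_card; lia.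
- move=> y B yB; rewrite /h'; case: eqP => [<-|_]; rewrite ?mulr1 ?mulr0 ?subr0 ?h0 //.
  by rewrite subr_ge0; apply: y1min.
(* The order [l] chooses exactly one element of each menu, so what is subtracted is itself a flow of
   value [m]. *)
- move=> B Bne; rewrite -(fl B Bne) -[m in RHS]mulr1 -(sum_max R l Bne) mulr_sumr -sumrB.
  apply: eq_bigr => y yB; rewrite sumrB -mulr_sumr; congr (_ - _ * _).
  have [sub|nsub] := boolP (B \subset lower l y).
    rewrite (bigD1 (lower l y)) //= eqxx big1 ?addr0 // => C /andP[_].
    by rewrite eq_sym => /negbTE->.
  by rewrite big1 // => C BC; case: eqP => // e; rewrite e BC in nsub.
exists (fun k => mu k + m * (k == l)%:R) => [k|y B yB].
  by apply: addr_ge0 => //; apply: mulr_ge0; rewrite ?ler0n ?(ltW m0).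
rewrite big_split /= muE // -mulr_sumr /h'.
rewrite (_ : \sum_(_ | _) _ = (lower l y == B)%:R) ?subrK //.
case: (boolP (lower l y == B)) => e.
  by rewrite (bigD1 l) //= eqxx big1 ?addr0 // => k /andP[_ /negbTE->].
by rewrite big1 // => k kB; case: eqP => // ekl; rewrite -ekl kB in e.
Qed.

End Flow.

(** * Truncation and Moebius inversion *)

Section Vectors.
Variable T : nat.

Lemma upd_at (U : Type) (f : {ffun 'I_T -> U}) (k : 'I_T) u : upd f k u k = u.
Proof. by rewrite ffunE eqxx. Qed.

Lemma upd_lt (U : Type) (f : {ffun 'I_T -> U}) (k i : 'I_T) u :
  (i < k)%N -> upd f k u i = f i.
Proof. by rewrite ffunE => /ltn_eqF->. Qed.

Lemma eq_pre (U : Type) (i : 'I_T) (f g : {ffun 'I_T -> U}) :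
  (forall j : 'I_T, (j < i)%N -> f j = g j) -> pre i f = pre i g.
Proof. by move=> H; apply: eq_from_tnth => j; rewrite !tnth_mktuple H /=. Qed.

(** Isolates coordinate [k] of a sum over a product; the remaining coordinates are carried by
    vectors with the dummy value [z0] at [k]. *)
Lemma sum_upd (V : nmodType) (U : finType) (Z : 'I_T -> pred U) (k : 'I_T) (z0 : U)
    (F : {ffun 'I_T -> U} -> V) :
  \sum_(f : {ffun 'I_T -> U} | [forall i, Z i (f i)]) F f =
  \sum_(f : {ffun 'I_T -> U} | [forall i, if i == k then f i == z0 else Z i (f i)])
     \sum_(u | Z k u) F (upd f k u).
Proof.
rewrite pair_big_dep /= (reindex_onto (fun fu => upd fu.1 k fu.2)
  (fun g => (upd g k z0, g k))) /=; last first.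
  by move=> g _; apply/ffunP => j; rewrite !ffunE; case: eqP => // /val_inj->.
apply: eq_bigl => -[f u] /=; rewrite upd_at xpair_eqE eqxx andbT.
have -> : (upd (upd f k u) k z0 == f) = (f k == z0).
  apply/eqP/eqP => [<-|e]; first by rewrite upd_at.
  by apply/ffunP => j; rewrite !ffunE; case: (nat_of_ord j =P k) => // /val_inj->.
apply/andP/andP => [[/forallP H fk]|[/forallP H Zu]]; split.
- apply/forallP => i; case: eqP => [->//|ne]; have := H i; rewrite ffunE.
  by case: (nat_of_ord i =P k) => [/val_inj//|].
- by have := H k; rewrite upd_at.
- apply/forallP => i; rewrite ffunE; have := H i.
  by case: (i =P k) => [->|ne]; rewrite ?eqxx //; case: (nat_of_ord i =P k) => [/val_inj//|].
- by have := H k; rewrite eqxx.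
Qed.

End Vectors.

Section Dynamic.
Variables (X : finType) (R : realType) (T : nat).
Implicit Types (x : vX X T) (A : vA X T) (f p : vX X T -> vA X T -> R).

Definition agree (k : nat) x x' := [forall i : 'I_T, (i < k)%N ==> (x' i == x i)].

Definition cut (k : nat) A : vA X T := [ffun i : 'I_T => if (i < k)%N then A i else setT].

(** A closed form of [marg], indexed by the number of periods kept instead of dropped. On [mobius p]
    it gives the Moebius inverse of the marginal of [p], as [trunc_zeta] shows. *)
Definition trunc f (k : nat) x A := \sum_(x' | agree k x x') f x' (cut k A).

Lemma agreeP k x x' : reflect (forall i : 'I_T, (i < k)%N -> x' i = x i) (agree k x x').
Proof.
apply: (iffP forallP) => H i; first by move=> ik; have := H i; rewrite ik => /eqP.
by apply/implyP => /H->.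
Qed.

Lemma eq_trunc f k x x' A A' : (forall i : 'I_T, (i < k)%N -> x i = x' i) ->
  (forall i : 'I_T, (i < k)%N -> A i = A' i) -> trunc f k x A = trunc f k x' A'.
Proof.
move=> Hx HA; rewrite /trunc; have -> : cut k A = cut k A'.
  by apply/ffunP => i; rewrite !ffunE; case: ifP => // /HA.
apply: eq_bigl => z; apply/agreeP/agreeP => H i ik; by rewrite H // Hx.
Qed.

Lemma sum_trunc f (k : 'I_T) x A (B C : {set X}) :
  \sum_(y in B) trunc f k.+1 (upd x k y) (upd A k C) =
  \sum_(x' | agree k x x' && (x' k \in B)) f x' (cut k.+1 (upd A k C)).
Proof.
rewrite [RHS](partition_big (fun x' => x' k) (mem B)) /=; last by move=> ? /andP[].
apply: eq_bigr => y yB; apply: eq_bigl => x'.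
apply/agreeP/andP => [H|[/andP[/agreeP H _] /eqP ky] i].
  have e : x' k = y by rewrite H // upd_at.
  rewrite e yB eqxx andbT; split=> //; apply/agreeP => i ik.
  by rewrite H ?upd_lt // ltnS ltnW.
rewrite ltnS leq_eqVlt => /orP[/eqP/val_inj->|ik]; first by rewrite upd_at.
by rewrite upd_lt // H.
Qed.

Lemma trunc_step f (k : 'I_T) x A :
  \sum_y trunc f k.+1 (upd x k y) (upd A k setT) = trunc f k x A.
Proof.
have := sum_trunc f k x A setT setT; under eq_bigl do rewrite inE.
move=> ->; rewrite (_ : cut _ _ = cut k A).
  by apply: eq_bigl => x'; rewrite inE andbT.
apply/ffunP => i; rewrite !ffunE ltnS leq_eqVlt.
by case: eqP => [->|_] /=; rewrite ?ltnn.
Qed.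

Lemma trunc_full f x A : trunc f T x A = f x A.
Proof.
rewrite /trunc (big_pred1 x) => [|x'].
  by congr (f x _); apply/ffunP => i; rewrite ffunE ltn_ord.
apply/agreeP/eqP => [H|->//]; by apply/ffunP => i; apply: H.
Qed.

Lemma margE f k x A : (k <= T)%N -> marg f k x A = trunc f (T - k) x A.
Proof.
elim: k x A => [|k IH] x A kT; first by rewrite subn0 trunc_full.
have lt : (T - k.+1 < T)%N by lia.
rewrite /= -(trunc_step f (Ordinal lt) x A) /=; apply: eq_bigr => y _.
by rewrite IH ?(ltnW kT) //; congr trunc; lia.
Qed.

Definition leA A A' := [forall i, A i \subset A' i].

Lemma leA_trans A B C : leA A B -> leA B C -> leA A C.
Proof.
by move=> /forallP AB /forallP BC; apply/forallP => i; apply: subset_trans (BC i).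
Qed.

Lemma leA_refl A : leA A A. Proof. by apply/forallP. Qed.

(** The sum factors over the periods into instances of [altsum]. *)
Lemma altsum_vec A C : leA A C ->
  \sum_(B : vA X T | leA A B && leA B C) (-1) ^+ (\sum_i #|B i :\: A i|)%N
   = (A == C)%:R :> R.
Proof.
move=> /forallP AC.
pose Q i := [pred D : {set X} | (A i \subset D) && (D \subset C i)].
transitivity (\prod_i \sum_(D | Q i D) (-1) ^+ #|D :\: A i| : R).
  rewrite bigA_distr_big_dep; apply: eq_big => [B|B _]; last by rewrite -expr_sum.
  apply/andP/familyP => [[/forallP H /forallP K] i|H]; first by rewrite inE H K.
  by split; apply/forallP => i; have := H i; rewrite inE => /andP[].
under eq_bigr do rewrite altsum //.
case: eqP => [->|ne]; first by rewrite big1 // => i _; rewrite eqxx.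
case: (pickP (fun i => A i != C i)) => [i Ai|H].
  by rewrite (bigD1 i) //= (negbTE Ai) mul0r.
by case: ne; apply/ffunP => i; move: (H i) => /= /negbFE/eqP.
Qed.

Lemma zeta_mobius p x A : \sum_(B | leA A B) mobius p x B = p x A.
Proof.
rewrite /mobius; under eq_bigr do rewrite -/(leA _ _).
rewrite (exchange_big_dep (fun C => leA A C)) /=; last first.
  by move=> B C AB BC; apply: leA_trans AB BC.
rewrite (bigD1 A) ?leA_refl //= [X in _ + X]big1 ?addr0.
  rewrite (big_pred1 A) => [|B].
    by rewrite big1 ?expr0 ?mul1r // => i _; rewrite setDv cards0.
  apply/andP/eqP => [[/forallP AB /forallP BA]|->]; last by split; apply: leA_refl.
  by apply/ffunP => i; apply/eqP; rewrite eqEsubset AB BA.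
move=> C /andP[AC CA]; rewrite -mulr_suml.
(* Cardinalities add along A, B, C, so the sign of the step from B to C is a constant times the sign
   of the step from A to B, to which [altsum_vec] applies. *)
have -> : \sum_(B | leA A B && leA B C) (-1) ^+ (\sum_i #|C i :\: B i|)%N = 
  (-1) ^+ (\sum_i #|C i :\: A i|)%N * 
  \sum_(B | leA A B && leA B C) (-1) ^+ (\sum_i #|B i :\: A i|)%N :> R.
  rewrite mulr_sumr; apply: eq_bigr => B /andP[/forallP AB /forallP BC].
  have -> : (\sum_i #|C i :\: A i| = \sum_i #|C i :\: B i| + \sum_i #|B i :\: A i|)%N.
    rewrite -big_split; apply: eq_bigr => i _ /=; rewrite !cardsD.
    rewrite (setIidPr (AB i)) (setIidPr (BC i)) (setIidPr (subset_trans (AB i) (BC i))).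
    by have := subset_leq_card (AB i); have := subset_leq_card (BC i); lia.
  by rewrite exprD -mulrA -expr2 sqrr_sign mulr1.
by rewrite altsum_vec // eq_sym (negbTE CA) mulr0 mul0r.
Qed.

(** Truncation commutes with the zeta transform because a superset of the full menu is the full
    menu. *)
Lemma trunc_zeta p k x A :
  trunc p k x A = \sum_(B | leA (cut k A) B) trunc (mobius p) k x B.
Proof.
rewrite /trunc; under eq_bigr do rewrite -zeta_mobius.
rewrite exchange_big /=; apply: eq_bigr => B /forallP AB; apply: eq_bigr => x' _.
congr (mobius p x' _); apply/ffunP => i; rewrite ffunE; case: ifP => // ik.
by apply/eqP; rewrite -subTset; have := AB i; rewrite ffunE ik.
Qed.

End Dynamic.

(** * Probabilities of histories *)

Lemma sum_max_lin (X : finType) (R : realFieldType) (g : lin X -> R) (B : {set X}) :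
  B != set0 -> \sum_(y in B) \sum_(l | B \subset lower l y) g l = \sum_l g l.
Proof.
move=> Bne; under eq_bigr do rewrite big_mkcond; rewrite exchange_big /=.
apply: eq_bigr => l _; rewrite -[RHS]mulr1 -(sum_max R l Bne) mulr_sumr.
by apply: eq_bigr => y _; case: ifP; rewrite ?mulr1 ?mulr0.
Qed.

Lemma flow_total (X : finType) (R : realFieldType) (h : X -> {set X} -> R) c (mu : lin X -> R) :
  [set: X] != set0 -> is_flow h c ->
  (forall y (B : {set X}), y \in B -> \sum_(l | lower l y == B) mu l = h y B) -> \sum_l mu l = c.
Proof.
move=> Xne fl muE; rewrite -(fl _ Xne) -(sum_max_lin mu Xne); apply: eq_bigr => y _.
rewrite (big_pred1 setT) => [|B]; last by rewrite subTset.
by rewrite -muE ?inE //; apply: eq_bigl => l; rewrite subTset.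
Qed.

Lemma delta_distr (U : finType) (R : realType) (u : U) :
  is_distr (fun v => (v == u)%:R : R).
Proof.
split=> [v|]; first by rewrite ler0n.
by rewrite (bigD1 u) //= eqxx big1 ?addr0 // => v /negbTE->.
Qed.

Section Process.
Variables (X : finType) (R : realType) (T : nat) (o0 : lin X).
Variable w : forall n, n.-tuple X -> n.-tuple (lin X) -> lin X -> R.
Implicit Types (x : vX X T) (A : vA X T) (o : {ffun 'I_T -> lin X}).
Implicit Types (C : 'I_T -> pred (lin X)).

(** The kernel [w] includes degree 0, which plays the role of the initial distribution, so all
    periods are treated alike. *)
Definition path_prob (k : nat) x o : R :=
  \prod_(i < T | (i < k)%N) w (pre i x) (pre i o) (o i).

(* Total weight of the histories of the first [k] periods whose orders satisfy
   [C]; such a history is padded with [o0] to a vector of length [T]. *)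
Definition hist_prob (k : nat) C x : R :=
  \sum_(o : {ffun 'I_T -> lin X} | [forall i : 'I_T, if (i < k)%N then C i (o i) else o i == o0])
    path_prob k x o.

Lemma hist_prob0 C x : hist_prob 0 C x = 1.
Proof.
rewrite /hist_prob (big_pred1 [ffun=> o0]) /path_prob ?big_pred0 // => o.
apply/forallP/eqP => [H|-> i]; last by rewrite ffunE.
by apply/ffunP => i; rewrite ffunE; apply/eqP/H.
Qed.

(** Among the first [k.+1] factors only the last involves the order of the last period, so that
    order can be summed separately. *)
Lemma hist_probS (k : 'I_T) C x : hist_prob k.+1 C x =
  \sum_(o : {ffun 'I_T -> lin X} | [forall i : 'I_T, if (i < k)%N then C i (o i) else o i == o0])
    path_prob k x o * \sum_(l | C k l) w (pre k x) (pre k o) l.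
Proof.
rewrite /hist_prob.
rewrite (sum_upd (fun (i : 'I_T) l => if (i < k.+1)%N then C i l else l == o0) k o0).
apply: eq_big => [o|o _].
  apply: eq_forallb => i; rewrite ltnS leq_eqVlt -val_eqE /=.
  by case: (nat_of_ord i =P k) => [->|]; rewrite ?ltnn.
rewrite mulr_sumr /= ltnSn; apply: eq_bigr => l _.
rewrite /path_prob (bigD1 k) //= upd_at mulrC; congr (_ * _); last first.
  by congr (w _ _); apply: eq_pre => j; apply: upd_lt.
apply: eq_big => [i|i]; first by rewrite ltnS ltn_neqAle andbC.
move=> /andP[ik ne]; have {ne}ik : (i < k)%N by rewrite ltn_neqAle ne.
rewrite upd_lt //; congr (w _ _ _); apply: eq_pre => j ji; apply: upd_lt.
exact: ltn_trans ik.
Qed.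

Lemma eq_hist_prob k C C' x x' :
  (forall (i : 'I_T) l, (i < k)%N -> C i l = C' i l) ->
  (forall i : 'I_T, (i < k)%N -> x i = x' i) ->
  hist_prob k C x = hist_prob k C' x'.
Proof.
move=> HC Hx; apply: eq_big => [o|o _].
  by apply: eq_forallb => i; case: ifP => // /HC.
apply: eq_bigr => i ik; congr (w _ _ _); apply: eq_pre => j ji; apply: Hx.
exact: ltn_trans ik.
Qed.

Lemma hist_prob_full C x : hist_prob T C x =
  \sum_(o : {ffun 'I_T -> lin X} | [forall i, C i (o i)]) \prod_i w (pre i x) (pre i o) (o i).
Proof.
apply: eq_big => [o|o _]; first by apply: eq_forallb => i; rewrite ltn_ord.
by apply: eq_bigl => i; rewrite ltn_ord.
Qed.

Definition choice_prob (k : nat) x A := hist_prob k (fun i l => A i \subset lower l (x i)) x.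

(** After any past the next order has total mass one and chooses exactly one element of [B]: this is
    marginality inside the model. *)
Lemma sum_choice_prob (k : 'I_T) x A (B : {set X}) :
  (forall n (xs : n.-tuple X) os, (n < T)%N -> \sum_l w xs os l = 1) -> B != set0 ->
  \sum_(y in B) choice_prob k.+1 (upd x k y) (upd A k B) = choice_prob k x A.
Proof.
move=> w1 Bne.
transitivity (\sum_(y in B)
  \sum_(o : {ffun 'I_T -> lin X} | [forall i : 'I_T,
      if (i < k)%N then A i \subset lower (o i) (x i) else o i == o0])
    path_prob k x o * \sum_(l | B \subset lower l y) w (pre k x) (pre k o) l).
  apply: eq_bigr => y _; rewrite /choice_prob hist_probS; apply: eq_big => [o|o _].
    by apply: eq_forallb => i; case: ifP => // ik; rewrite !upd_lt.
  congr (_ * _).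
    apply: eq_bigr => i ik; congr (w _ _ _); apply: eq_pre => j ji; apply: upd_lt.
    exact: ltn_trans ik.
  rewrite !upd_at; apply: eq_bigr => l _; congr (w _ _ _).
  by apply: eq_pre => j; apply: upd_lt.
rewrite exchange_big /=; apply: eq_bigr => o _.
by rewrite -mulr_sumr sum_max_lin // w1 ?mulr1.
Qed.

End Process.

(** * Necessity of marginality and complete monotonicity *)

Section Necessity.
Variables (X : finType) (R : realType) (T : nat) (o0 : lin X).
Implicit Types (x : vX X T) (A B : vA X T).
Variable w : forall n, n.-tuple X -> n.-tuple (lin X) -> lin X -> R.
Hypothesis w0 : forall n (xs : n.-tuple X) os l, (n < T)%N -> 0 <= w xs os l.
Hypothesis w1 : forall n (xs : n.-tuple X) os, (n < T)%N -> \sum_l w xs os l = 1.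
Variable p : vX X T -> vA X T -> R.
Hypothesis pE : forall x A, vin x A -> p x A = choice_prob o0 w T x A.

(** Induction on the number of dropped periods: summing over choices from the full menu removes the
    last period on both sides. *)
Lemma trunc_choice_prob k x A : (k <= T)%N -> (forall i : 'I_T, (i < k)%N -> x i \in A i) ->
  trunc p k x A = choice_prob o0 w k x A.
Proof.
move=> kT; rewrite -(subKn kT); elim: (T - k)%N (leq_subr k T) x A => {k kT} [|d IH] dT x A xA.
  by rewrite subn0 trunc_full pE //; apply/forallP => i; apply: xA; rewrite subn0.
have lt : (T - d.+1 < T)%N by lia.
pose k := Ordinal lt; have kS : (T - d = k.+1)%N by rewrite /=; lia.
rewrite -[(T - d.+1)%N]/(nat_of_ord k) -trunc_step -(sum_choice_prob o0 k x A w1 (B := setT)).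
  under [RHS]eq_bigl do rewrite inE.
  apply: eq_bigr => y _; rewrite -kS IH ?(ltnW dT) // kS => i.
  rewrite ltnS leq_eqVlt => /orP[/eqP/val_inj->|ik]; first by rewrite !upd_at inE.
  by rewrite !upd_lt //; apply: xA.
by apply/set0Pn; exists (x k).
Qed.

Lemma choice_prob_marginality : marginality p.
Proof.
move=> tau /andP[tau1 tauT] x A Ane xA B C Bne Cne.
have lt : (tau < T)%N by lia.
suff H D : D != set0 -> \sum_(y in D) marg p (T - tau.+1) (upd x tau y) (upd A tau D) =
    choice_prob o0 w tau x A by rewrite !H.
move=> Dne; rewrite -(sum_choice_prob o0 (Ordinal lt) x A w1 Dne); apply: eq_bigr => y yD.
rewrite margE ?leq_subr // subKn // trunc_choice_prob // => i.
pose k := Ordinal lt; rewrite -[tau]/(nat_of_ord k).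
rewrite ltnS leq_eqVlt => /orP[/eqP/val_inj->|ik]; first by rewrite !upd_at.
by rewrite !upd_lt //; apply: xA.
Qed.

(** After exchanging sums, the alternating sum over menus keeps only the histories whose lower sets
    are exactly [A], and their weights are nonnegative. *)
Lemma choice_prob_monotone : complete_monotonicity p.
Proof.
move=> x A _ /forallP xA; rewrite /mobius.
rewrite [leRHS](_ : _ = \sum_(B | leA A B)
  \sum_(o : {ffun 'I_T -> lin X} | leA B [ffun i => lower (o i) (x i)])
  (-1) ^+ (\sum_i #|B i :\: A i|)%N * \prod_i w (pre i x) (pre i o) (o i)); last first.
  apply: eq_bigr => B /forallP AB.
  rewrite pE; last by apply/forallP => i; apply: (subsetP (AB i)).
  rewrite /choice_prob hist_prob_full mulr_sumr; apply: eq_bigl => o.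
  by apply: eq_forallb => i; rewrite ffunE.
rewrite (exchange_big_dep
  (fun o : {ffun 'I_T -> lin X} => leA A [ffun i => lower (o i) (x i)])) /=; last first.
  by move=> B o; apply: leA_trans.
apply: sumr_ge0 => o Ao; rewrite -mulr_suml altsum_vec //.
by rewrite mulr_ge0 ?ler0n //; apply: prodr_ge0 => i _; apply: w0.
Qed.

End Necessity.

(** * Construction of the transitions *)

Section Sufficiency.
Variables (X : finType) (R : realType) (T : nat).
Variable p : vX X T -> vA X T -> R.
Hypotheses (hp : is_rjcr p) (hm : marginality p) (hc : complete_monotonicity p).
Implicit Types (x : vX X T) (A : vA X T) (B : {set X}).

Lemma vin_vne x A : vin x A -> vne A.
Proof. by move=> /forallP xA; apply/forallP => i; apply/set0Pn; exists (x i). Qed.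

(** Marginality extended to an empty past, where it becomes the normalization of [p] on a menu
    vector that is full after the first period. *)
Lemma sum_first_step (k : 'I_T) x A B :
  (forall i : 'I_T, (i < k)%N -> x i \in A i) -> B != set0 ->
  \sum_(y in B) trunc p k.+1 (upd x k y) (upd A k B) = trunc p k x A.
Proof.
move=> xA Bne; have Xne : [set: X] != set0.
  by case/set0Pn: Bne => y _; apply/set0Pn; exists y.
have [k0|kpos] := posnP k.
  have sum1 C : C != set0 ->
      \sum_(y in C) trunc p k.+1 (upd x k y) (upd A k C) = 1.
    move=> Cne; rewrite sum_trunc -[RHS](proj2 (hp (A := cut k.+1 (upd A k C)) _)).
      apply: eq_bigl => x'; apply/andP/forallP => [[_ xk] i|H].
        rewrite !ffunE k0; case: ltnP => ik; rewrite ?inE //.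
        have ei : i = k by apply: val_inj; rewrite /= k0; case: (val i) ik.
        by rewrite ei k0 eqxx.
      split; last by have := H k; rewrite !ffunE ltnSn eqxx.
      by apply/agreeP => i; rewrite k0.
    apply/forallP => i; rewrite !ffunE k0; case: ltnP => // ik.
    by have -> : (nat_of_ord i == 0)%N by case: (val i) ik.
  rewrite sum1 // -trunc_step -(sum1 setT Xne); apply: eq_bigl => y.
  by rewrite inE.
have kT := ltn_ord k.
have H (C : {set X}) : \sum_(y in C) trunc p k.+1 (upd x k y) (upd A k C) =
    \sum_(y in C) marg p (T - k.+1) (upd x k y) (upd A k C).
  by apply: eq_bigr => y _; rewrite margE ?leq_subr // subKn.
rewrite -trunc_step H (hm _ _ xA Bne Xne); last 2 first.
- by lia.
- by move=> i ik; apply/set0Pn; exists (x i); apply: xA.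
by rewrite -H; apply: eq_bigl => y; rewrite inE.
Qed.

Lemma trunc_mobius_ge0 k x A : (forall i : 'I_T, (i < k)%N -> x i \in A i) ->
  0 <= trunc (mobius p) k x A.
Proof.
move=> xA; apply: sumr_ge0 => x' /agreeP xx'.
have xA' : vin x' (cut k A).
  by apply/forallP => i; rewrite ffunE; case: ifP => ik; rewrite ?inE // xx' // xA.
exact: hc (vin_vne xA') xA'.
Qed.

(** As functions of the past menus, both sides have the same zeta transform: by [trunc_zeta] it
    consists of marginals of [p], which [sum_first_step] compares. *)
Lemma trunc_mobius_flow (k : 'I_T) x A : (forall i : 'I_T, (i < k)%N -> x i \in A i) ->
  is_flow (fun y B => trunc (mobius p) k.+1 (upd x k y) (upd A k B))
          (trunc (mobius p) k x A).
Proof.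
move=> xA B Bne.
pose F A' := \sum_(y in B) \sum_(B' : {set X} | B \subset B')
  trunc (mobius p) k.+1 (upd x k y) (upd A' k B').
(* Menus from period [k] on are pinned to the full set, so that vectors of length [T] stand for past
   menus. *)
pose P A' := [forall i : 'I_T, if (i < k)%N then x i \in A' i else A' i == setT].
have cutE (i : 'I_T) : (i < k)%N -> A i = cut k A i by rewrite ffunE => ->.
transitivity (F (cut k A)).
  apply: eq_bigr => y _; apply: eq_bigr => B' _; apply: eq_trunc => // i.
  rewrite ltnS leq_eqVlt => /orP[/eqP/val_inj->|ik]; first by rewrite !upd_at.
  by rewrite !upd_lt // cutE.
rewrite (@eq_trunc _ _ _ _ k x x A (cut k A)) //.
apply: (zeta_inj (P := P) (le := @leA X T) (m := fun A' => (\sum_i #|~: A' i|)%N)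
   (F := F) (G := trunc (mobius p) k x)).
- exact: leA_refl.
- move=> A1 A2 /forallP P1 /forallP le; apply/forallP => i; have := P1 i; have := le i.
  case: ifP => _ /subsetP le12; first exact: le12.
  by move=> /eqP e; rewrite -subTset; apply/subsetP; rewrite -e.
- move=> A1 A2 /forallP le ne.
  have /existsP[i nei] : [exists i, A1 i != A2 i].
    apply: contraR ne => /existsPn ne; apply/eqP/ffunP => i.
    by have := ne i; rewrite negbK => /eqP.
  rewrite (bigD1 i) //= [X in (_ < X)%N](bigD1 i) //= -addSn leq_add //.
    apply: proper_card; rewrite properE !setCS le /=.
    by apply: contra nei => le21; rewrite eqEsubset le.
  by apply: leq_sum => j _; apply: subset_leq_card; rewrite setCS.
- move=> A1 /forallP P1.
  have xA1 (i : 'I_T) : (i < k)%N -> x i \in A1 i by move=> ik; have := P1 i; rewrite ik.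
  have A1T (i : 'I_T) : (k <= i)%N -> A1 i = setT.
    by move=> ki; have := P1 i; rewrite ltnNge ki => /eqP.
  have A1cut : cut k A1 = A1.
    by apply/ffunP => i; rewrite ffunE; case: ltnP => // /A1T.
  rewrite -{2}A1cut -trunc_zeta -(sum_first_step xA1 Bne) exchange_big /=.
  apply: eq_bigr => y _; rewrite trunc_zeta.
  rewrite (sum_upd (fun i (D : {set X}) => cut k.+1 (upd A1 k B) i \subset D) k setT) /=.
  apply: eq_big => [A2|A2 _].
    apply: eq_forallb => i; rewrite !ffunE -val_eqE /= ltnS leq_eqVlt.
    case: (nat_of_ord i =P k) => [/val_inj->|_] /=; first by rewrite A1T // subTset.
    by case: ltnP => // /A1T->.
  by apply: eq_bigl => B'; rewrite !ffunE ltnSn eqxx.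
by apply/forallP => i; rewrite ffunE; case: ltnP => // ik; apply: xA.
Qed.

Variables (o0 : lin X) (x0 : X) (k0 : 'I_T).

Lemma trunc_mobius0 x A : trunc (mobius p) 0 x A = 1.
Proof.
have Xne : [set: X] != set0 by apply/set0Pn; exists x0.
transitivity (trunc p 0 x A).
  rewrite [RHS]trunc_zeta (big_pred1 [ffun=> setT]) => [|B]; first exact: eq_trunc.
  apply/forallP/eqP => [H|-> i]; last by rewrite !ffunE.
  by apply/ffunP => i; have := H i; rewrite !ffunE subTset => /eqP.
rewrite /trunc -[RHS](proj2 (hp (A := cut 0 A) _)).
  apply: eq_bigl => x'; apply/agreeP/forallP => // _ i; by rewrite ffunE inE.
by apply/forallP => i; rewrite ffunE.
Qed.

(** Histories are padded to length [T] by default values. The past orders will enter the transition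
    only through the lower sets of the past choices. *)
Definition past_choice n (xs : n.-tuple X) : vX X T := [ffun j : 'I_T => nth x0 xs j].
Definition past_lower n (xs : n.-tuple X) (os : n.-tuple (lin X)) : vA X T :=
  [ffun j : 'I_T => lower (nth o0 os j) (nth x0 xs j)].

Lemma past_choiceE (k i : 'I_T) x : (i < k)%N -> past_choice (pre k x) i = x i.
Proof.
move=> ik; rewrite ffunE (nth_mktuple _ _ (Ordinal ik)).
by congr (x _); apply: val_inj.
Qed.

Lemma past_lowerE (k i : 'I_T) x (o : {ffun 'I_T -> lin X}) : (i < k)%N ->
  past_lower (pre k x) (pre k o) i = lower (o i) (x i).
Proof.
move=> ik; rewrite ffunE !(nth_mktuple _ _ (Ordinal ik)).
by congr (lower (o _) (x _)); apply: val_inj.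
Qed.

Variable mu : 'I_T -> vX X T -> vA X T -> lin X -> R.
Hypothesis muP : forall (k : 'I_T) x A, (forall i : 'I_T, (i < k)%N -> x i \in A i) ->
  (forall l, 0 <= mu k x A l) /\
  forall y B, y \in B -> \sum_(l | lower l y == B) mu k x A l =
    trunc (mobius p) k.+1 (upd x k y) (upd A k B).

Lemma sum_mu (k : 'I_T) x A : (forall i : 'I_T, (i < k)%N -> x i \in A i) ->
  \sum_l mu k x A l = trunc (mobius p) k x A.
Proof.
move=> xA; apply: (flow_total _ (trunc_mobius_flow xA)); first by apply/set0Pn; exists x0.
exact: (muP xA).2.
Qed.

(* Where the past has probability 0, the transition is arbitrary. *)
Definition transition n (xs : n.-tuple X) (os : n.-tuple (lin X)) (l : lin X) : R :=
  let x := past_choice xs in let A := past_lower xs os in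
  if trunc (mobius p) n x A == 0 then (l == o0)%:R
  (* The default [k0] is only reached for [n] at least [T]. *)
  else mu (insubd k0 n) x A l / trunc (mobius p) n x A.

Lemma insubd_ord n (nT : (n < T)%N) : insubd k0 n = Ordinal nT.
Proof. by apply: val_inj; rewrite val_insubd nT. Qed.

Lemma transition_distr n (xs : n.-tuple X) os : (n < T)%N -> is_distr (transition xs os).
Proof.
move=> nT; rewrite /transition; set x := past_choice xs; set A := past_lower xs os.
have xA (i : 'I_T) : (i < n)%N -> x i \in A i by rewrite !ffunE lower_refl.
case: eqP => [_|/eqP Qne]; first exact: delta_distr.
rewrite insubd_ord; set k := Ordinal nT.
split=> [l|]; first by rewrite divr_ge0 ?trunc_mobius_ge0 // (muP (k := k) xA).1.
by rewrite -mulr_suml (sum_mu (k := k) xA) divff.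
Qed.

(** Telescoping: each transition multiplies the weight of the past by the ratio of two successive
    truncated Moebius inverses. *)
Lemma hist_prob_transition k x A : (k <= T)%N ->
  (forall i : 'I_T, (i < k)%N -> x i \in A i) ->
  hist_prob o0 transition k (fun i l => lower l (x i) == A i) x = trunc (mobius p) k x A.
Proof.
elim: k => [|k IH] kT xA; first by rewrite hist_prob0 trunc_mobius0.
have xA' (i : 'I_T) : (i < k)%N -> x i \in A i by move=> ik; apply: xA; apply: ltnW.
pose k' := Ordinal kT; rewrite (hist_probS o0 _ k').
pose Q := trunc (mobius p) k x A; pose Q' := trunc (mobius p) k.+1 x A.
(* Agreement before [k] is all that the padded vectors in [transition] provide. *)
have sum_muE x' A' : (forall i : 'I_T, (i < k)%N -> x' i = x i) ->
    (forall i : 'I_T, (i < k)%N -> A' i = A i) ->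
    \sum_(l | lower l (x k') == A k') mu k' x' A' l = Q'.
  move=> ex eA; rewrite (muP (k := k') _).2 ?xA //=; last first.
    by move=> i ik; rewrite ex // eA // xA'.
  apply: eq_trunc => i; rewrite -[k]/(nat_of_ord k').
    rewrite ltnS leq_eqVlt => /orP[/eqP/val_inj->|ik]; first by rewrite upd_at.
    by rewrite upd_lt // ex.
  rewrite ltnS leq_eqVlt => /orP[/eqP/val_inj->|ik]; first by rewrite upd_at.
  by rewrite upd_lt // eA.
pose K := if Q == 0 then \sum_(l | lower l (x k') == A k') (l == o0)%:R else Q' / Q.
transitivity (Q * K).
  rewrite /Q -IH ?(ltnW kT) // mulr_suml; apply: eq_bigr => o /forallP Ho.
  congr (_ * _).
  have ex (i : 'I_T) : (i < k)%N -> past_choice (pre k' x) i = x i.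
    exact: (@past_choiceE k').
  have eA (i : 'I_T) : (i < k)%N -> past_lower (pre k' x) (pre k' o) i = A i.
    by move=> ik; rewrite (@past_lowerE k') //; have := Ho i; rewrite ik => /eqP.
  rewrite /transition /K (eq_trunc (mobius p) ex eA) -/Q; case: eqP => // _.
  by rewrite -mulr_suml insubd_ord sum_muE.
rewrite /K -/Q'; case: eqP => [Q0|/eqP Qne]; last by rewrite mulrC divfK.
(* If the past has weight [Q = 0], then so has its continuation, since [Q'] is part of a nonnegative
   sum equal to [Q]. *)
rewrite Q0 mul0r; apply/esym/eqP; rewrite eq_le trunc_mobius_ge0 // andbT.
rewrite -Q0 -[X in X <= _](sum_muE x A) // /Q -(sum_mu (k := k') xA').
rewrite [leRHS](bigID (fun l => lower l (x k') == A k')) /= lerDl.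
by apply: sumr_ge0 => l _; rewrite (muP (k := k') xA').1.
Qed.

(** Sorting histories by the vector [B] of lower sets of the choices gives classes of weight
    [mobius p x B]; their sum over [B] above [A] is [p x A]. *)
Lemma transition_rationalizes x A : vin x A ->
  p x A = choice_prob o0 transition T x A.
Proof.
move=> /forallP xA; rewrite /choice_prob hist_prob_full -zeta_mobius.
rewrite (partition_big (fun o : {ffun 'I_T -> lin X} => [ffun i => lower (o i) (x i)])
  (leA A)) /=; last by move=> o /forallP Ao; apply/forallP => i; rewrite ffunE.
apply: eq_bigr => B AB; have /forallP AB' := AB.
rewrite -[LHS]trunc_full -hist_prob_transition //; last first.
  by move=> i _; apply: (subsetP (AB' i)).
rewrite hist_prob_full; apply: eq_bigl => o; apply/forallP/andP => [H|[_ /eqP <-] i].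
  have e : [ffun i => lower (o i) (x i)] = B.
    by apply/ffunP => i; rewrite ffunE; apply/eqP.
  by rewrite e eqxx; split=> //; apply/forallP => i; rewrite (eqP (H i)).
by rewrite ffunE.
Qed.

End Sufficiency.

Lemma initial_weightE (X : finType) (R : realType) (T : nat)
    (w : forall n, n.-tuple X -> n.-tuple (lin X) -> lin X -> R)
    (x : vX X T) (o : {ffun 'I_T -> lin X}) (i : 'I_T) :
  (if nat_of_ord i == 0%N then w 0%N [tuple] [tuple] (o i)
   else w i (pre i x) (pre i o) (o i)) = w i (pre i x) (pre i o) (o i).
Proof.
by case: i => [[|m] mT] //=; congr (w _ _ _); apply/esym; apply: tuple0.
Qed.

Theorem theorem11 (X : finType) (R : realType) (T : nat) (hT : (1 <= T)%N)
  (p : vX X T -> vA X T -> R) (hp : is_rjcr p) :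
  cdru p <-> marginality p /\ complete_monotonicity p.
Proof.
have [o0 _] := lin_inhabited X; split.
  move=> [nu [t [nuP [tP pE]]]].
  (* The initial distribution becomes the transition of degree 0. *)
  pose w n (xs : n.-tuple X) os l := if n == 0%N then nu l else t n xs os l.
  have wP n (xs : n.-tuple X) os : (n < T)%N -> is_distr (w n xs os).
    by rewrite /w; case: eqP => // /eqP n0 nT; apply: tP; lia.
  have {}pE x A : vin x A -> p x A = choice_prob o0 w T x A.
    move=> xA; rewrite pE ?(vin_vne xA) // /choice_prob hist_prob_full.
    by apply: eq_bigl => o; apply: eq_forallb => i; rewrite in_Nset.
  have w0 n (xs : n.-tuple X) os l : (n < T)%N -> 0 <= w n xs os l.
    by move=> nT; apply: (wP n xs os nT).1.
  have w1 n (xs : n.-tuple X) os : (n < T)%N -> \sum_l w n xs os l = 1.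
    by move=> nT; apply: (wP n xs os nT).2.
  by split; [apply: (choice_prob_marginality w1 pE) | apply: (choice_prob_monotone w0 pE)].
move=> [hm hc]; pose k0 := Ordinal hT.
(* For empty [X] there is no choice vector, as [T] is positive, so any distributions will do. *)
case: (pickP (@predT X)) => [x0 _|X0]; last first.
  exists (fun l => (l == o0)%:R), (fun _ _ _ l => (l == o0)%:R).
  do 2![split; first by move=> *; apply: delta_distr].
  by move=> x; have := X0 (x k0).
(* Finite choice selects one decomposition per period and past. Admissibility of the past is a
   premise inside [P], so inadmissible pasts can receive the zero weight. *)
pose P (u : 'I_T * vX X T * vA X T) (mu : lin X -> R) :=
  (forall i : 'I_T, (i < u.1.1)%N -> u.1.2 i \in u.2 i) ->
  (forall l, 0 <= mu l) /\ forall y (B : {set X}), y \in B -> \sum_(l | lower l y == B) mu l =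
    trunc (mobius p) u.1.1.+1 (upd u.1.2 u.1.1 y) (upd u.2 u.1.1 B).
have [[[k x] A]|mu muP] := @fin_all_exists _ (fun=> lin X -> R) P.
  have [/forallP xAb|nxA] := boolP [forall i : 'I_T, (i < k)%N ==> (x i \in A i)].
    have xA (i : 'I_T) : (i < k)%N -> x i \in A i by move=> ik; exact: implyP (xAb i) ik.
    have [|mu mu0 muE] := flow_decomposition _ (trunc_mobius_flow hp hm xA).
      move=> y B yB; apply: trunc_mobius_ge0 => // i.
      rewrite ltnS leq_eqVlt => /orP[/eqP/val_inj->|ik]; first by rewrite !upd_at.
      by rewrite !upd_lt ?xA.
    by exists mu.
  exists (fun=> 0) => xA; case/negP: nxA; apply/forallP => i; apply/implyP; exact: xA.
have {}muP (k : 'I_T) x A := muP (k, x, A).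
pose t := transition p o0 x0 k0 (fun k x A => mu (k, x, A)).
have tP n (xs : n.-tuple X) os : (n < T)%N -> is_distr (t n xs os).
  exact: transition_distr.
exists (t 0%N [tuple] [tuple]), t; split; first exact: tP.
split=> [n /andP[n1 nT] xs os|x A _ xA]; first by apply: tP; lia.
rewrite (transition_rationalizes hp hm hc o0 x0 k0 muP xA) /choice_prob hist_prob_full.
apply: eq_big => [o|o _]; first by apply: eq_forallb => i; rewrite in_Nset.
by apply: eq_bigr => i _; rewrite initial_weightE.
Qed.
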